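(* Let $G=(V,E)$ be a finite directed graph (possibly cyclic) and consider a finite functional causal model on $G$. Let $G_1,G_2\in\mathcal G_{\mathrm{tele}}(G)$ be any two teleportation graphs of $G$, with split-vertex sets $S_1,S_2$, and for $i\in\{1,2\}$ consider a classical teleportation model on $G_i$ constructed from the given model on $G$. Assume that the conditional probabilities below are defined, i.e. the post-selection success probabilities $P_{\mathrm{acyc}}(\{t_v=1\}_{v\in S_i})_{G_i}$, $i\in\{1,2\}$, are non-zero. Then $$P_{\mathrm{acyc}}\big(x\mid\{t_v=1\}_{v\in S_1}\big)_{G_1}=P_{\mathrm{acyc}}\big(x\mid\{t_v=1\}_{v\in S_2}\big)_{G_2}$$ for all joint observed events $x=\{x_v\in\mathcal X_v\}_{v\in V}$.
   Context: Graphs. A directed graph $G=(V,E)$ has a finite vertex set $V$ and edges $E\subseteq V\times V$, $(v,w)$ being an edge from $v$ to $w$. $\mathrm{Pa}(v)=\{w:(w,v)\in E\}$, $\mathrm{Ch}(v)=\{w:(v,w)\in E\}$, $\mathrm{out}(v)=\{(v,w)\in E\}$. Finite functional causal model (fCM) on $G$. To each $v\in V$ assign: a random variable $X_v$ with values $x_v$ in a non-empty finite set $\mathcal X_v$; an error variable $U_v$ with values $u_v$ in a finite set $\mathcal U_v$ with probability distribution $p^v$ on $\mathcal U_v$; a function $f^v:\prod_{w\in \mathrm{Pa}(v)}\mathcal X_w\times\mathcal U_v\to\mathcal X_v$. If $G$ is acyclic, its distribution is $P_{\mathrm{acyc}}(x)_G=\sum_u\prod_{v\in V}p^v(u_v)\,\delta_{x_v,f^v(x_{\mathrm{Pa}(v)},u_v)}$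 for $x=\{x_v\}_{v\in V}$, the sum being over all $u=\{u_v\in\mathcal U_v\}_{v\in V}$; marginals and conditionals are obtained from it as usual. Classical post-selected teleportation protocol on a finite set $\mathcal X_A=\mathcal X_C$: a finite set $\mathcal X_B$, a function $g:\mathcal X_A\times\mathcal X_B\times\mathcal X_C\to\{0,1\}$ and probability distributions $q_B$ on $\mathcal X_B$, $q_C$ on $\mathcal X_C$ such that for all probability distributions $p^A$ on $\mathcal X_A$ and all $c\in\mathcal X_C$, $\sum_{a,b}p^A(a)\,\delta_{g(a,b,c),1}\,q_B(b)\,q_C(c)=p_{\mathrm{tele}}\,p^A(c)$, where $p_{\mathrm{tele}}\in(0,1]$ (independent of $p^A$) is the success probability. Teleportation graphs. The family $\mathcal G_{\mathrm{tele}}(G)$ consists of all graphs $G_{\mathrm{t}}$ obtained thus: choose $S\subseteq V$ (''split vertices'') such that $(V,E')$ with $E'=E\setminus\bigcup_{v\in S}\mathrm{out}(v)$ is acyclic. The vertices of $G_{\mathrm t}$ are $V\cup\{R_v\}_{v\in S}\cup\{T_v\}_{v\in S}$ with new vertices $R_v$ (pre-selection) and $T_v$ (post-selection). The edges are $E'\cup\{(v,T_v),(R_v,T_v)\}_{v\in S}\cup\{(R_v,w): v\in S,\ w\in\mathrm{Ch}(v)\text{ in }G\}$. All such $G_{\mathrm t}$ are acyclic. Teleportation models. Given an fCM on $G$ and $G_{\mathrm t}\in\mathcal G_{\mathrm{tele}}(G)$, a classical teleportation model on $G_{\mathrm t}$ is an fCM in which: for each $v\in S$, $T_v$ takes values $t_v\in\{0,1\}$,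 $R_v$ takes values $r_v\in\mathcal X_v$ and equals its error variable, and the function $f^{T_v}$ with the error distributions $p^{T_v},p^{R_v}$ form a classical post-selected teleportation protocol ($g=f^{T_v}$ with arguments the value of $v$, the error of $T_v$, and the value of $R_v$; $q_B=p^{T_v}$, $q_C=p^{R_v}$); every $w\in V$ keeps the same sets, error variable and function as in the fCM on $G$, where $r_v$ replaces $x_v$ as an input for each $v\in S\cap \mathrm{Pa}(w)$ (parents in $G$). *)

(* Defs.v *)
From mathcomp Require Import all_boot all_order all_algebra.

Set Implicit Arguments.
Unset Strict Implicit.
Unset Printing Implicit Defensive.

Import Order.TTheory GRing.Theory Num.Theory.
Local Open Scope ring_scope.

(* A directed graph on a finite vertex type [V] is a relation [E : rel V], with
   [E v w] meaning that (v, w) is an edge from v to w. *)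

(* No closed directed walk of positive length; self-loops count as cycles. *)
Definition acyclic (V : finType) (E : rel V) : Prop :=
  forall s : seq V, cycle E s -> s = [::].

Definition Pa (V : finType) (E : rel V) (v : V) : {set V} := [set w | E w v].

Definition Ch (V : finType) (E : rel V) (v : V) : {set V} := [set w | E v w].

Definition is_distr (R : realFieldType) (T : finType) (p : T -> R) : Prop :=
  (forall t, 0 <= p t) /\ \sum_t p t = 1.

Record fcm (R : realFieldType) (V : finType) (E : rel V) := Fcm {
  val_set : V -> finType;
  val_set_gt0 : forall v, (0 < #|val_set v|)%N;
  err_set : V -> finType;
  err_pr : forall v, err_set v -> R;
  err_prP : forall v, is_distr (@err_pr v);
  mech : forall v, {dffun forall w : {w | w \in Pa E v}, val_set (val w)} ->
           err_set v -> val_set v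
}.

Section Distribution.
Variables (R : realFieldType) (V : finType) (E : rel V) (M : fcm R E).

Definition event : finType := {dffun forall v, val_set M v}.

Definition restrict_pa (x : event) (v : V) :
    {dffun forall w : {w | w \in Pa E v}, val_set M (val w)} :=
  finfun (fun w : {w | w \in Pa E v} => x (val w)).

(* The formula is total, but it is only meant for acyclic [E]: on a cyclic graph
   it need not be normalised. *)
Definition P_acyc (x : event) : R :=
  \sum_(u : {dffun forall v, err_set M v})
    \prod_v (err_pr (u v) * (x v == mech (restrict_pa x v) (u v))%:R).

Definition Pr_acyc (A : pred event) : R := \sum_(x | A x) P_acyc x.

Definition cond_acyc (A B : pred event) : R :=
  Pr_acyc (predI A B) / Pr_acyc B.

End Distribution.

Arguments P_acyc {R V E} M x.
Arguments Pr_acyc {R V E} M A.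
Arguments cond_acyc {R V E} M A B.

(* Here X_A = X_C = [X], and {0, 1} is rendered as [bool]. *)
Record protocol (R : realFieldType) (X : finType) := Protocol {
  prot_B : finType;
  prot_g : X -> prot_B -> X -> bool;
  prot_qB : prot_B -> R;
  prot_qC : X -> R;
  prot_qBP : is_distr prot_qB;
  prot_qCP : is_distr prot_qC;
  p_tele : R;
  p_teleP : 0 < p_tele <= 1;
  prot_teleports : forall pA : X -> R, is_distr pA -> forall c : X,
    \sum_a \sum_b pA a * (prot_g a b c == true)%:R * prot_qB b * prot_qC c
      = p_tele * pA c
}.

Section TeleportationGraph.
Variables (V : finType) (E : rel V) (S : {set V}).

Definition cut_edge : rel V := [rel v w | E v w && (v \notin S)].

Definition is_split : Prop := acyclic cut_edge.

Definition split_vertex : finType := {v : V | v \in S}.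

Definition tele_vertex : finType := (V + (split_vertex + split_vertex))%type.

Definition Orig (v : V) : tele_vertex := inl v.
Definition Pre (v : split_vertex) : tele_vertex := inr (inl v).
Definition Post (v : split_vertex) : tele_vertex := inr (inr v).

Definition tele_edge : rel tele_vertex := fun y z =>
  match y, z with
  | inl v, inl w => cut_edge v w
  | inl v, inr (inr t) => v == val t
  | inr (inl r), inr (inr t) => r == t
  | inr (inl r), inl w => w \in Ch E (val r)
  | _, _ => false
  end.

Lemma tele_edge_acyclic : is_split -> acyclic tele_edge.
Proof.
move=> acE s cs.
have inV z : z \in s -> exists v, z = Orig v.
  move=> zs; have := next_cycle cs zs; have := prev_cycle cs zs.
  case: z {zs} => [v|[r|t]]; first by exists v.
    by case: (prev s _) => [?|[?|?]].
  by case: (prev s _); case: (next s _) => [?|[?|?]].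
have [s' def_s] : exists s', s = map Orig s'.
  elim: s inV {cs} => [|z s IHs] inV; first by exists [::].
  have [v ->] := inV z (mem_head z s).
  have [z' z's|s' ->] := IHs; first by apply: inV; rewrite inE z's orbT.
  by exists (v :: s').
suff /acE s'0: cycle cut_edge s' by rewrite def_s s'0.
by move: cs; rewrite def_s cycle_map.
Qed.

Lemma Pre_in_Pa (v : V) (w : V) (wS : w \in S) :
  w \in Pa E v -> Pre (exist _ w wS) \in Pa tele_edge (Orig v).
Proof. by rewrite /Pa !inE /= /Ch inE. Qed.

Lemma Orig_in_Pa (v : V) (w : V) (wS : ~ w \in S) :
  w \in Pa E v -> Orig w \in Pa tele_edge (Orig v).
Proof. by rewrite /Pa !inE /= /cut_edge /= => ->; apply/negP. Qed.

Lemma Orig_in_PaT (t : split_vertex) : Orig (val t) \in Pa tele_edge (Post t).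
Proof. by rewrite /Pa inE /=. Qed.

Lemma Pre_in_PaT (t : split_vertex) : Pre t \in Pa tele_edge (Post t).
Proof. by rewrite /Pa inE /=. Qed.

End TeleportationGraph.

Section TeleportationModel.
Variables (R : realFieldType) (V : finType) (E : rel V) (M : fcm R E).
Variables (S : {set V}) (tau : forall v : split_vertex S, protocol R (val_set M (val v))).

Definition tele_val (z : tele_vertex S) : finType :=
  match z with
  | inl v => val_set M v
  | inr (inl r) => val_set M (val r)
  | inr (inr t) => bool
  end.

Definition tele_err (z : tele_vertex S) : finType :=
  match z with
  | inl v => err_set M v
  | inr (inl r) => val_set M (val r)
  | inr (inr t) => prot_B (tau t)
  end.

Definition tele_pr (z : tele_vertex S) : tele_err z -> R :=
  match z with
  | inl v => @err_pr R V E M v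
  | inr (inl r) => @prot_qC R _ (tau r)
  | inr (inr t) => @prot_qB R _ (tau t)
  end.

Definition tele_inputs (z : tele_vertex S) : finType :=
  {dffun forall y : {y | y \in Pa (tele_edge E (S := S)) z}, tele_val (val y)}.

(* The inputs of an original vertex [v], indexed by its parents in the original
   graph: the value of R_w is read in place of that of a split parent w. *)
Definition orig_inputs (v : V) (y : tele_inputs (Orig S v)) :
    {dffun forall w : {w | w \in Pa E v}, val_set M (val w)} :=
  finfun (fun w : {w | w \in Pa E v} =>
    match @idP (val w \in S) with
    | ReflectT wS => y (exist _ (Pre (exist _ (val w) wS)) (Pre_in_Pa wS (valP w)))
    | ReflectF wNS => y (exist _ (Orig S (val w)) (Orig_in_Pa wNS (valP w)))
    end).

Definition tele_mech (z : tele_vertex S) :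
    tele_inputs z -> tele_err z -> tele_val z :=
  match z with
  | inl v => fun y u => mech (orig_inputs y) u
  | inr (inl r) => fun _ u => u
  | inr (inr t) => fun y u =>
      prot_g (y (exist _ (Orig S (val t)) (Orig_in_PaT E t))) u
             (y (exist _ (Pre t) (Pre_in_PaT E t)))
  end.

Lemma tele_val_gt0 (z : tele_vertex S) : (0 < #|tele_val z|)%N.
Proof. by case: z => [v|[r|t]] /=; rewrite ?val_set_gt0 ?card_bool. Qed.

Lemma tele_prP (z : tele_vertex S) : is_distr (@tele_pr z).
Proof.
by case: z => [v|[r|t]] /=; [exact: err_prP|exact: prot_qCP|exact: prot_qBP].
Qed.

Definition tele_model : fcm R (tele_edge E (S := S)) :=
  Fcm tele_val_gt0 tele_prP tele_mech.

Definition observed (x : event M) : pred (event tele_model) :=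
  fun y => [forall v, (y (Orig S v) : val_set M v) == x v].

Definition post_selected : pred (event tele_model) :=
  fun y => [forall t : split_vertex S, (y (Post t) : bool) == true].

End TeleportationModel.

Arguments tele_model {R V E M S} tau.
Arguments observed {R V E M S} tau x y.
Arguments post_selected {R V E M S} tau y.

(* Main.v *)
(* Summing out the errors, the formula for [P_acyc M x] is a product of local
   kernels, which makes sense on a cyclic graph too.  Teleporting a point mass
   shows that the kernels of R_v and T_v (at t_v = 1) multiply to
   p_tele times the indicator of x_v = r_v.  Hence the joint probability of x and
   successful post-selection is the product of the p_tele times [P_acyc M x], and
   conditioning gives [P_acyc M x / \sum_x' P_acyc M x'] whatever the split. *)
Require Import Defs.
From mathcomp Require Import all_boot all_order all_algebra.
Local Open Scope ring_scope.

Import Order.TTheory GRing.Theory Num.Theory.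

Lemma sum_dffun_prod {R : comPzSemiRingType} {I : finType} {T : I -> finType}
    (F : forall i, T i -> R) :
  \sum_(u : {dffun forall i, T i}) \prod_i F i (u i) = \prod_i \sum_t F i t.
Proof.
rewrite (reindex (@dffun_of_fprod _ T)) /=; last first.
  by apply: onW_bij; exact: dffun_of_fprod_bij.
transitivity (\sum_(f : fprod T) \prod_(i in I) [ffun t => F i t] (f i)).
  by apply: eq_bigr => f _; apply: eq_bigr => i _; rewrite !ffunE.
(* [untag 0] extends each factor to the common tagged type, where non-dependent distributivity
   applies; the sums stay on matching tags, so the default 0 is never read. *)
rewrite big_fprod -(bigA_distr_big_dep _ (fun i => untag 0 [ffun t => F i t])).
apply: eq_bigr => i _; rewrite -(big_tag (fun i => [ffun t => F i t])).
by apply: eq_bigr => t _; rewrite ffunE.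
Qed.

Section Kernel.
Context {R : realFieldType} {V : finType} {E : rel V} (M : fcm R E).

(** The conditional probability of [x v] given the values of the parents of [v]. *)
Definition kernel (x : event M) (v : V) : R :=
  \sum_(u : err_set M v)
    err_pr u * (x v == mech (restrict_pa x v) u)%:R.

Lemma P_acyc_kernel (x : event M) : P_acyc M x = \prod_v kernel x v.
Proof. exact: sum_dffun_prod. Qed.

Lemma Pr_acyc_partition {J : finType} (f : event M -> J) (B : pred (event M)) :
  Pr_acyc M B = \sum_x Pr_acyc M (predI (fun y => f y == x) B).
Proof.
rewrite /Pr_acyc (partition_big f predT) //.
by apply: eq_bigr => x _; apply: eq_bigl => y; rewrite /= andbC.
Qed.

End Kernel.

(* Teleporting the point mass at [a]. *)
Lemma protocol_kernel {R : realFieldType} {X : finType} (tau : protocol R X)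
    (a c : X) :
  (\sum_(b : prot_B tau) prot_qB b * (true == prot_g a b c)%:R) * prot_qC tau c
    = p_tele tau * (a == c)%:R.
Proof.
have delta_distr : is_distr (fun a' => (a == a')%:R : R).
  split=> [a'|]; first exact: ler0n.
  by rewrite (bigD1 a) //= eqxx big1 ?addr0 // => a' /negbTE; rewrite eq_sym => ->.
rewrite -(prot_teleports tau delta_distr c) (bigD1 a) //= [X in _ + X]big1 ?addr0.
  rewrite mulr_suml; apply: eq_bigr => b _.
  by rewrite eqxx mul1r [true == _]eq_sym [prot_qB _ * _]mulrC.
move=> a' /negbTE; rewrite eq_sym => a'a.
by apply: big1 => b _; rewrite a'a !mul0r.
Qed.

Section Teleportation.
Context {R : realFieldType} {V : finType} {E : rel V} {M : fcm R E}.
Context {S : {set V}}.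
Variable tau : forall v : split_vertex S, protocol R (val_set M (val v)).

Let T := tele_model tau.

Lemma kernel_Pre (y : event T) (r : split_vertex S) :
  kernel T y (Pre r) = prot_qC (tau r) (y (Pre r)).
Proof.
rewrite /kernel /= (bigD1 (y (Pre r) : val_set M (val r))) //= eqxx mulr1.
by rewrite big1 ?addr0 // => u /negbTE; rewrite eq_sym => ->; rewrite mulr0.
Qed.

Lemma kernel_Post (y : event T) (t : split_vertex S) :
  y (Post t) = true ->
  kernel T y (Post t) * kernel T y (Pre t)
    = p_tele (tau t) * (y (Orig S (val t)) == y (Pre t) :> val_set M (val t))%:R.
Proof.
move=> yt; rewrite kernel_Pre -protocol_kernel; congr (_ * _).
by apply: eq_bigr => b _; rewrite /= !ffunE yt.
Qed.

(** The only event compatible with [x] and successful post-selection that can have non-zero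
    probability: each pre-selected value agrees with its split vertex. *)
Definition tele_event (x : event M) : event T :=
  [ffun z => match z return tele_val M z with
             | inl v => x v
             | inr (inl r) => x (val r)
             | inr (inr t) => true
             end].

(** Each [Pre] vertex carries the value of its split vertex, so both branches of [orig_inputs]
    return the original input. *)
Lemma kernel_Orig (x : event M) (v : V) :
  kernel T (tele_event x) (Orig S v) = kernel M x v.
Proof.
apply: eq_bigr => u _ /=; rewrite ffunE; congr (_ * (_ == mech _ _)%:R).
by apply/ffunP => w; rewrite !ffunE; case: {-}_ / idP => wS; rewrite !ffunE.
Qed.

(* Each post-selection vertex is paired with its pre-selection vertex: only the
   product of their two kernels is determined by the protocol. *)
Lemma P_acyc_tele (y : event T) :
  P_acyc T y = \prod_v kernel T y (Orig S v) *
               \prod_(t : split_vertex S)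
                  (kernel T y (Post t) * kernel T y (Pre t)).
Proof.
by rewrite P_acyc_kernel !big_sumType /= big_split /= [X in _ * X]mulrC.
Qed.

Lemma Pr_observed_post_selected (x : event M) :
  Pr_acyc T (predI (observed tau x) (post_selected tau))
    = \prod_t p_tele (tau t) * P_acyc M x.
Proof.
rewrite /Pr_acyc (bigD1 (tele_event x)) /=; last first.
  by apply/andP; split; apply/forallP => v; rewrite ffunE.
rewrite big1 ?addr0 => [|y /andP[/andP[/forallP obs /forallP post] ny]].
  rewrite P_acyc_tele P_acyc_kernel mulrC; congr (_ * _).
    apply: eq_bigr => t _; rewrite kernel_Post ?ffunE //.
    by rewrite eqxx mulr1.
  by apply: eq_bigr => v _; exact: kernel_Orig.
(* The observed and post-selected values are fixed, so [y] can differ from [tele_event x] only at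
   some [Pre r]; the kernel pair at [r] then vanishes. *)
have [r yr] : exists r : split_vertex S,
    y (Orig S (val r)) != y (Pre r) :> val_set M (val r).
  apply/existsP; apply: contraNT ny; rewrite negb_exists => /forallP eq_pre.
  apply/eqP/ffunP => -[v|[r|t]]; rewrite ffunE.
  - exact/eqP/obs.
  - have := eq_pre r; rewrite negbK => /eqP <-; exact/eqP/obs.
  - exact/eqP/post.
rewrite P_acyc_tele [X in _ * X](bigD1 r) //= kernel_Post; last exact/eqP/post.
by rewrite (negbTE yr) mulr0 mul0r mulr0.
Qed.

Lemma cond_acyc_tele (x : event M) :
  cond_acyc T (observed tau x) (post_selected tau)
    = P_acyc M x / \sum_x' P_acyc M x'.
Proof.
have p_neq0 : \prod_t p_tele (tau t) != 0.
  by apply/prodf_neq0 => t _; have /andP[/gt_eqF -> _] := p_teleP (tau t).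
rewrite /cond_acyc Pr_observed_post_selected.
(* Splitting the denominator by the values at the original vertices gives one numerator for each
   [x'], so the product of the [p_tele] cancels. *)
rewrite (Pr_acyc_partition T (fun y => [ffun v => y (Orig S v)] : event M)).
rewrite (eq_bigr (fun x' => \prod_t p_tele (tau t) * P_acyc M x')) => [|x' _].
  by rewrite -mulr_sumr -mulf_div divff ?mul1r.
rewrite -Pr_observed_post_selected; apply: eq_bigl => y /=; congr (_ && _).
apply/eqP/forallP => [<- v|obs]; first by rewrite ffunE.
by apply/ffunP => v; rewrite ffunE; exact/eqP/obs.
Qed.

End Teleportation.

Theorem proposition1 (R : realFieldType) (V : finType) (E : rel V)
  (M : fcm R E) (S1 S2 : {set V})
  (split1 : is_split E S1) (split2 : is_split E S2)
  (tau1 : forall v : split_vertex S1, protocol R (val_set M (val v)))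
  (tau2 : forall v : split_vertex S2, protocol R (val_set M (val v)))
  (success1 : Pr_acyc (tele_model tau1) (post_selected tau1) != 0)
  (success2 : Pr_acyc (tele_model tau2) (post_selected tau2) != 0)
  (x : event M) :
  cond_acyc (tele_model tau1) (observed tau1 x) (post_selected tau1) =
  cond_acyc (tele_model tau2) (observed tau2 x) (post_selected tau2).
Proof. by rewrite !cond_acyc_tele. Qed.
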